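(* Let $m\in\mathbb{Z}$. Let $U_m$ be the linear operator defined on (Laurent) polynomials in $s$ by $U_m s^k = q^{m\binom{k}{2}} s^k$, and define polynomials $\Phi_n(x,s,m,q)$ for $n\ge 0$ by $\Phi_n(x,s,m,q) := U_m\, Fib_n(x,s,q)$, i.e. $$\Phi_n(x,s,m,q)=\sum_{k=0}^{\lfloor (n-1)/2\rfloor} q^{\binom{k+1}{2}+m\binom{k}{2}}\begin{bmatrix} n-1-k\\ k\end{bmatrix}s^k x^{n-1-2k}.$$ Then: (1) For all integers $i,j\in\mathbb{Z}$ and all $n\ge 0$, $$U_m\left(s^j Fib_n(x,q^i s,q)\right)=s^j q^{m\binom{j}{2}}\,\Phi_n(x,q^{i+mj}s,m,q).$$ (2) These polynomials satisfy, for all $n\ge 2$, $$\Phi_n(x,s,m,q)=x\,\Phi_{n-1}(x,s,m,q)+(q-1)s\,D\Phi_{n-1}(x,q^m s,m,q)+s\,\Phi_{n-2}(x,q^m s,m,q),$$ with initial values $\Phi_0(x,s,m,q)=0$ and $\Phi_1(x,s,m,q)=1$. (3) More generally the same type of recurrence holds for all linear combinations of the polynomials $s^k\Phi_n(x,q^{km}s,m,q)$ with complex coefficients: if $(c_k)_{k\ge 0}$ is a finitely supported family of complex numbers (independent of $n$) and $G_n(x,s)=\sum_k c_k s^k\Phi_n(x,q^{km}s,m,q)$, then for all $n\ge 2$ $$G_n(x,s)=x\,G_{n-1}(x,s)+(q-1)s\,D G_{n-1}(x,q^m s)+s\,G_{n-2}(x,q^m s).$$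
   Context: Here $q$, $x$, $s$ are indeterminates, and $U_m$ is linear over the coefficients not involving $s$ (i.e. it acts coefficientwise in $x$ and $q$). For integer $k$ (possibly negative), $\binom{k}{2}=k(k-1)/2$. Write $[n]=\frac{1-q^n}{1-q}$, $[n]!=[1][2]\cdots[n]$, and $\begin{bmatrix} n\\ k\end{bmatrix}=\frac{[n]!}{[k]![n-k]!}$ for $0\le k\le n$ (the $q$-binomial coefficient). The $q$-Fibonacci polynomials $Fib_n$ are $$Fib_n(x,s,q)=\sum_{k=0}^{\lfloor (n-1)/2\rfloor} q^{\binom{k+1}{2}}\begin{bmatrix} n-1-k\\ k\end{bmatrix}s^k x^{n-1-2k}\quad(n\ge 0),$$ where the empty sum gives $Fib_0=0$. $D$ is the $q$-differentiation operator with respect to $x$: $Df(x)=\frac{f(x)-f(qx)}{(1-q)x}$. An expression $D\Phi_{n-1}(x,q^m s,m,q)$ means: substitute $q^m s$ for $s$ and apply $D$ in the variable $x$. *)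

(* Defs.v *)
From HB Require Import structures.
From mathcomp Require Import all_boot all_order all_algebra.
From mathcomp Require Import finmap.
From mathcomp Require Import reals.
From mathcomp Require Import complex.
From mathcomp Require Import monalg.

Set Implicit Arguments.
Unset Strict Implicit.
Unset Printing Implicit Defensive.

Import GRing.Theory.

Local Open Scope ring_scope.

(** Laurent polynomials R[s, 1/s].  The library ring structure on
    [{malg R[M]}] requires a monoid [M] without non-trivial invertible
    elements, which excludes [(int, +)]; the convolution product is therefore
    put on an alias. *)
Definition laurent (R : comNzRingType) : Type := {malg R[int]}.

HB.instance Definition _ (R : comNzRingType) :=
  GRing.Lmodule.copy (laurent R) {malg R[int]}.

Section LaurentRing.
Variable R : comNzRingType.
Implicit Types (f g h : laurent R) (k l : int) (a b : R).

Definition laurent_one : laurent R := mkmalgU (0 : int) (1 : R).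

Definition laurent_mul f g : laurent R :=
  \sum_(k <- msupp f) \sum_(l <- msupp g) << f@_k * g@_l *g (k + l)%R >>.

Local Notation "f ** g" := (laurent_mul f g) (at level 40).

Lemma laurent_mulEw (d1 d2 : {fset int}) f g :
  (msupp f `<=` d1)%fset -> (msupp g `<=` d2)%fset ->
  f ** g = \sum_(k <- d1) \sum_(l <- d2) << f@_k * g@_l *g (k + l)%R >>.
Proof.
move=> le1 le2; rewrite /laurent_mul (big_fset_incl _ le1) /=.
  apply: eq_bigr => k _; apply: big_fset_incl => // l _ /mcoeff_outdom ->.
  by rewrite mulr0 monalgU0.
move=> k _ /mcoeff_outdom fk.
by rewrite big1 // => l _; rewrite fk mul0r monalgU0.
Qed.

Lemma laurent_mulC : commutative laurent_mul.
Proof.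
move=> f g; rewrite /laurent_mul exchange_big /=.
by apply: eq_bigr => k _; apply: eq_bigr => l _; rewrite mulrC addrC.
Qed.

Lemma laurent_mulDl : left_distributive laurent_mul +%R.
Proof.
move=> f g h; set d := (msupp f `|` msupp g)%fset.
rewrite (@laurent_mulEw d (msupp h)) ?fsubset_refl ?msuppD_le //.
rewrite (@laurent_mulEw d (msupp h) f) ?fsubset_refl ?fsubsetUl //.
rewrite (@laurent_mulEw d (msupp h) g) ?fsubset_refl ?fsubsetUr //.
rewrite -big_split; apply: eq_bigr => k _.
rewrite -big_split; apply: eq_bigr => l _.
by rewrite /= mcoeffD mulrDl monalgUD.
Qed.

Lemma laurent_mulDr : right_distributive laurent_mul +%R.
Proof.
by move=> f g h; rewrite laurent_mulC laurent_mulDl !(laurent_mulC f).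
Qed.

Lemma laurent_mul0l : left_zero 0 laurent_mul.
Proof. by move=> f; rewrite /laurent_mul msupp0 big_seq_fset0. Qed.

Lemma laurent_mul0r : right_zero 0 laurent_mul.
Proof. by move=> f; rewrite laurent_mulC laurent_mul0l. Qed.

Lemma laurent_mulUU a b k l :
  << a *g k >> ** << b *g l >> = << a * b *g (k + l)%R >>.
Proof.
by rewrite (laurent_mulEw msuppU_le msuppU_le) !big_seq_fset1 !mcoeffUU.
Qed.

Lemma laurent_mul1 : left_id laurent_one laurent_mul.
Proof.
move=> f; rewrite (laurent_mulEw msuppU_le (fsubset_refl _)) big_seq_fset1.
rewrite [RHS]monalgE; apply: eq_bigr => k _.
by rewrite mcoeffUU mul1r add0r.
Qed.

Lemma laurent_mulA : associative laurent_mul.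
Proof.
have A a b c k l j : << a *g k >> ** (<< b *g l >> ** << c *g j >>) =
    (<< a *g k >> ** << b *g l >>) ** << c *g j >>.
  by rewrite !laurent_mulUU mulrA addrA.
have ext (P : laurent R -> laurent R) : P 0 = 0 -> {morph P : x y / x + y} ->
    forall x, P x = \sum_(k <- msupp x) P << x@_k *g k >>.
  by move=> P0 PD x; rewrite {1}[x]monalgE (big_morph P PD P0).
move=> f g h.
rewrite (ext (fun f => f ** (g ** h))) ?laurent_mul0l //; last first.
  by move=> ? ?; rewrite laurent_mulDl.
rewrite [RHS](ext (fun f => (f ** g) ** h)) ?laurent_mul0l //; last first.
  by move=> ? ?; rewrite !laurent_mulDl.
apply: eq_bigr => k _; set fk := << _ *g k >>.
rewrite (ext (fun g => fk ** (g ** h))) ?laurent_mul0l ?laurent_mul0r //;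
  last by move=> ? ?; rewrite laurent_mulDl laurent_mulDr.
rewrite [RHS](ext (fun g => (fk ** g) ** h)) ?laurent_mul0r ?laurent_mul0l //;
  last by move=> ? ?; rewrite laurent_mulDr laurent_mulDl.
apply: eq_bigr => l _; set gl := << _ *g l >>.
rewrite (ext (fun h => fk ** (gl ** h))) ?laurent_mul0r //;
  last by move=> ? ?; rewrite !laurent_mulDr.
rewrite [RHS](ext (laurent_mul (fk ** gl))) ?laurent_mul0r //;
  last by move=> ? ?; rewrite laurent_mulDr.
by apply: eq_bigr => j _; apply: A.
Qed.

Lemma laurent_one_neq0 : laurent_one != 0.
Proof. by rewrite /laurent_one monalgU_eq0 oner_eq0. Qed.

HB.instance Definition _ := GRing.Zmodule_isComNzRing.Build (laurent R)
  laurent_mulA laurent_mulC laurent_mul1 laurent_mulDl laurent_one_neq0.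

End LaurentRing.

Definition smonom (R : comNzRingType) (k : int) : laurent R :=
  mkmalgU k (1 : R).

Lemma smonom0 (R : comNzRingType) : smonom R 0 = 1.
Proof. by []. Qed.

Lemma smonomD (R : comNzRingType) (k l : int) :
  smonom R (k + l) = smonom R k * smonom R l.
Proof. by rewrite [RHS]laurent_mulUU mulr1. Qed.

Lemma laurent_coefZ (R : comNzRingType) (a : R) (f : laurent R) (k : int) :
  mcoeff k (a *: f) = a * mcoeff k f.
Proof. exact: mcoeffZ. Qed.

Lemma laurent_coefMs (R : comNzRingType) (j k : int) (f : laurent R) :
  mcoeff k (smonom R j * f) = mcoeff (k - j) f.
Proof.
have -> : smonom R j * f = \sum_(l <- msupp f) << mcoeff l f *g (j + l)%R >>.
  rewrite [LHS](laurent_mulEw msuppU_le (fsubset_refl _)) big_seq_fset1.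
  by apply: eq_bigr => l _; rewrite mcoeffUU mul1r.
rewrite [in RHS](monalgE f) (raddf_sum (mcoeff k)) (raddf_sum (mcoeff (k - j))).
apply: eq_bigr => l _; rewrite /= !mcoeffU.
by rewrite [in RHS]eq_sym subr_eq eq_sym (addrC l).
Qed.

(** Coefficientwise maps: [f = \sum_k f_k s^k] is sent to
    [\sum_k (h k f_k) s^k]. *)
Definition laurent_map (R : comNzRingType) (h : int -> R -> R)
    (f : laurent R) : laurent R :=
  \sum_(k <- msupp f) h k (mcoeff k f) *: smonom R k.

Lemma laurent_mapE (R : comNzRingType) (h : int -> R -> R) (f : laurent R) k :
  (forall l, h l 0 = 0) -> mcoeff k (laurent_map h f) = h k (mcoeff k f).
Proof.
move=> h0; rewrite /laurent_map raddf_sum /=.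
have E l : mcoeff k (h l (mcoeff l f) *: smonom R l)
    = h l (mcoeff l f) *+ (l == k).
  by rewrite laurent_coefZ mcoeffU mulrnAr mulr1.
rewrite (eq_bigr _ (fun l _ => E l)).
have [kf|kf] := boolP (k \in msupp f).
  rewrite (big_fsetD1 k) //= eqxx big1_fset ?addr0 // => l.
  by rewrite in_fsetD1 => /andP[/negPf ->].
rewrite (mcoeff_outdom kf) h0 big1_fset // => l lf _.
by case: eqP kf lf => // -> /negPf ->.
Qed.

(** The scalars are the rational functions [F(q)] and the Laurent polynomials
    are taken over [F(q)[x]]: negative powers of [q] occur when [m < 0]. *)
Section QFibonacci.
Variable F : fieldType.

Local Notation K := {fraction {poly F}}.
Local Notation Kx := {poly K}.
Local Notation L := (laurent Kx).

Local Notation tofrac := (@FracField.tofrac _).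

Definition qvar : K := tofrac ('X : {poly F}).
Local Notation q := qvar.

Definition qscal (c : F) : Kx := (tofrac (c%:P : {poly F}))%:P.

Lemma qvarX_neq1 n : (0 < n)%N -> q ^+ n != 1.
Proof.
move=> n0; rewrite -tofracXn -tofrac1 tofrac_eq.
apply/eqP => /(congr1 (fun p : {poly F} => size p)).
by rewrite size_polyXn size_poly1; case: n n0.
Qed.

Definition qint (n : nat) : K := (1 - q ^+ n) / (1 - q).
Definition qfact (n : nat) : K := \prod_(1 <= i < n.+1) qint i.
Definition qbinom (n k : nat) : K := qfact n / (qfact k * qfact (n - k)).

Definition binz2 (k : int) : int := ((k * (k - 1)) %/ 2)%Z.

Definition qderiv (f : Kx) : Kx :=
  (f - (f \Po (q *: 'X))) %/ ((1 - q) *: 'X).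

Lemma qderiv_exact f : (1 - q) *: 'X * qderiv f = f - (f \Po (q *: 'X)).
Proof.
have q1 : 1 - q != 0 by rewrite subr_eq0 eq_sym -(expr1 q) qvarX_neq1.
rewrite /qderiv mulrC divpK // dvdpZl //.
have := dvdp_XsubCl (f - (f \Po (q *: 'X))) 0; rewrite subr0 => ->.
by rewrite /root hornerD hornerN horner_comp hornerZ hornerX mulr0 subrr.
Qed.

Definition D (f : L) : L := laurent_map (fun _ => qderiv) f.

(** [ssubst i f] is [f(x, q^i s)]. *)
Definition ssubst (i : int) (f : L) : L :=
  laurent_map (fun k a => (q ^ (i * k)) *: a) f.

Definition U (m : int) (f : L) : L :=
  laurent_map (fun k a => (q ^ (m * binz2 k)) *: a) f.

Lemma U_is_linear m : linear (U m).
Proof.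
move=> a f g; apply/malgP => k.
rewrite raddfD /= laurent_coefZ !laurent_mapE => [|*|*|*]; rewrite ?scaler0 //.
by rewrite raddfD /= laurent_coefZ scalerDr scalerAr.
Qed.

HB.instance Definition _ m :=
  GRing.isLinear.Build Kx L L *:%R (U m) (U_is_linear m).

Lemma U_smonom m k :
  U m (smonom Kx k) = (q ^ (m * binz2 k))%:P *: smonom Kx k.
Proof.
apply/malgP => l; rewrite laurent_coefZ laurent_mapE; last first.
  by move=> *; rewrite scaler0.
rewrite mcoeffU; case: eqP => [->|_]; last by rewrite scaler0 mulr0.
by rewrite mul_polyC.
Qed.

(** The bound [n.+1./2] is [floor((n-1)/2) + 1], so the sum is empty for
    [n = 0]. *)
Definition Fib (n : nat) : L :=
  \sum_(0 <= k < n.+1./2)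
    ((q ^+ 'C(k.+1, 2) * qbinom (n - 1 - k) k) *: 'X^(n - 1 - 2 * k)) *:
      smonom Kx k.

Definition Phi (m : int) (n : nat) : L := U m (Fib n).

Definition G (m : int) (c : {fsfun nat -> F with 0}) (n : nat) : L :=
  \sum_(k <- finsupp c)
    qscal (c k) *: (smonom Kx k * ssubst (k%:Z * m) (Phi m n)).

End QFibonacci.

(* Main.v *)
Require Import Defs.
From HB Require Import structures.
From mathcomp Require Import all_boot all_order all_algebra.
From mathcomp Require Import finmap reals complex monalg.
From mathcomp Require Import zify ring.

Set Implicit Arguments.
Unset Strict Implicit.
Unset Printing Implicit Defensive.

Import GRing.Theory.
Local Open Scope ring_scope.

(** Everything follows from the case m = 0, the recurrence
      Fib_n = x Fib_(n-1) + (q - 1) s D Fib_(n-1) + s Fib_(n-2),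
    by applying U_m to it.

    Since binom(j + l, 2) = binom(j, 2) + binom(l, 2) + j l ([binz2D]), the
    operator U_m turns multiplication by s^j into multiplication by
    q^(m binom(j, 2)) s^j followed by the substitution s -> q^(m j) s; this is
    part (1), [U_smonom_ssubst].  For j = 1 it says that U_m carries f -> s f
    to f -> s f(x, q^m s).  As U_m also commutes with x and with D, it carries
    any solution of the recurrence with m = 0 to a solution of the recurrence
    for m ([U_fib_rec]), which gives part (2).

    For part (3), multiplying the recurrence for Fib by a polynomial P in s
    whose coefficients do not involve x leaves its form unchanged, because D
    commutes with such a P ([spolyM_fib_rec]).  By part (1),
    G_n = U_m (P Fib_n) when P is the sum of the c_k q^(-m binom(k, 2)) s^k
    ([G_spoly]), so the previous argument applies to G_n.

    There remains the recurrence for Fib ([Fib_rec]).  Compared at s^(k+1), it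
    is an identity between three terms ([fib_coef_rec]) which reduces to two
    relations for Gaussian binomials: the Pascal rule ([qbinom_pascal]) and
    (1 - q^(d+1)) [k+d+1, k] = (1 - q^(k+d+1)) [k+d, k] ([qbinom_absorb]). *)

(** * Binomial coefficients of integers *)

Lemma mul2_binz2 (k : int) : 2 * binz2 k = k * (k - 1).
Proof.
rewrite /binz2 mulrC divzK //.
have [h|h] := boolP (2 %| k)%Z; first exact: dvdz_mulr.
apply: dvdz_mull; lia.
Qed.

(** The cocycle relation behind part (1): the cross term j l is what becomes
    the substitution s -> q^(m j) s. *)
Lemma binz2D (j l : int) : binz2 (j + l) = binz2 j + binz2 l + j * l.
Proof.
apply: (@mulfI _ (2 : int)) => //.
by rewrite !mulrDr !mul2_binz2; ring.
Qed.

Lemma binz2_nat (k : nat) : binz2 k = 'C(k, 2).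
Proof.
elim: k => [//|k IHk].
by rewrite -addn1 PoszD binz2D IHk addn1 binS bin1 mulr1 PoszD addr0.
Qed.

(** * Identities between abstract scalars *)

(** The Pascal rule with Gaussian binomials written as fractions: f, g, a, b
    stand for [k]!, [d]!, [k+1], [d+1], and p for q^(d+1).  Stating it over an
    abstract field keeps normalisation from unfolding the field of rational
    functions. *)
Lemma pascal_fractions (k : fieldType) (u f g a b p : k) :
  f != 0 -> g != 0 -> a != 0 -> b != 0 ->
  u * (b + p * a) / (f * a * (g * b))
  = u / (f * a * g) + p * (u / (f * (g * b))).
Proof. by move=> ? ? ? ?; field; do ![apply/andP; split]. Qed.

Lemma absorb_fractions (k : fieldType) (u c f g a : k) :
  f != 0 -> g != 0 -> a != 0 ->
  a * (u * c / (f * (g * a))) = c * (u / (f * g)).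
Proof. by move=> ? ? ?; field; do ![apply/andP; split]. Qed.

(** In the generic case p = q^(k+1), r = q^(d+1), t = q^(d+2), u = q^binom(k+1, 2),
    and a, b, c stand for [k+d+1, k+1], [k+d+1, k] and [k+d+2, k]. *)
Lemma fib_coef_identity (k : comRingType) (p r t u a b c : k) :
  (1 - t) * c = (1 - p * r) * b ->
  p * u * (a + r * b) = p * u * a + (t - 1) * (u * c) + u * b.
Proof.
move=> E; have -> : (t - 1) * (u * c) = - (u * ((1 - t) * c)) by ring.
by rewrite E; ring.
Qed.

(** * Laurent polynomials over an arbitrary ring *)

Section LaurentMap.
Variable R : comNzRingType.
Implicit Types (f g h : laurent R) (k l : int) (a b : R).

Lemma laurent_coefD f g k : mcoeff k (f + g) = mcoeff k f + mcoeff k g.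
Proof. exact: mcoeffD. Qed.

Lemma coef_fib_step a b f g h l :
  mcoeff l (a *: f + b *: (smonom R 1 * g) + smonom R 1 * h)
  = a * mcoeff l f + b * mcoeff (l - 1) g + mcoeff (l - 1) h.
Proof. by rewrite 2!laurent_coefD 2!laurent_coefZ 2!laurent_coefMs. Qed.

(** Constant Laurent polynomials: they turn scaling into multiplication, so
    that identities mixing both become identities in a commutative ring. *)
Definition laurentC a : laurent R := mkmalgU (0 : int) a.

Lemma laurent_scaleE a f : a *: f = laurentC a * f.
Proof.
rewrite [RHS](laurent_mulEw msuppU_le (fsubset_refl _)) big_seq_fset1.
rewrite [LHS]malgZ_def; apply: eq_bigr => k _.
by rewrite mcoeffUU add0r.
Qed.

Lemma laurent_scaleA a b f : a *: (b *: f) = (a * b) *: f.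
Proof. exact: scalerA. Qed.

Lemma laurent_scaleAl a f g : (a *: f) * g = a *: (f * g).
Proof. by rewrite 2!laurent_scaleE mulrA. Qed.

Lemma laurent_scaleAr a f g : f * (a *: g) = a *: (f * g).
Proof. by rewrite 2!laurent_scaleE mulrCA. Qed.

Lemma mul_fib_step a b p s f g h :
  p * (a *: f + b *: (s * g) + s * h)
  = a *: (p * f) + b *: (s * (p * g)) + s * (p * h).
Proof. by rewrite 4!laurent_scaleE; ring. Qed.

Variable u : int -> R -> R.
Hypothesis u0 : forall l, u l 0 = 0.

Lemma laurent_map_add f g :
  (forall l, {morph u l : a b / a + b}) ->
  laurent_map u (f + g) = laurent_map u f + laurent_map u g.
Proof.
move=> uD; apply/malgP => l.
by rewrite laurent_mapE // [RHS]mcoeffD !laurent_mapE // mcoeffD uD.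
Qed.

Lemma laurent_map_scale a f :
  (forall l b, u l (a * b) = a * u l b) ->
  laurent_map u (a *: f) = a *: laurent_map u f.
Proof.
move=> uZ; apply/malgP => l.
by rewrite laurent_mapE // !laurent_coefZ laurent_mapE.
Qed.

Lemma scale_laurent_map a f :
  a *: laurent_map u f = laurent_map (fun l b => a * u l b) f.
Proof.
apply/malgP => l.
by rewrite laurent_coefZ !laurent_mapE // => k; rewrite u0 mulr0.
Qed.

Lemma laurent_map_smonomM k f :
  laurent_map u (smonom R k * f)
  = smonom R k * laurent_map (fun l => u (k + l)) f.
Proof.
apply/malgP => l.
by rewrite laurent_mapE // !laurent_coefMs laurent_mapE // subrKC.
Qed.

Lemma laurent_map_comp (v : int -> R -> R) f :
  (forall l, v l 0 = 0) ->
  laurent_map u (laurent_map v f) = laurent_map (fun l a => u l (v l a)) f.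
Proof.
move=> v0; apply/malgP => l.
by rewrite !laurent_mapE // => j; rewrite v0.
Qed.

Lemma eq_laurent_map (v : int -> R -> R) f :
  (forall l a, u l a = v l a) -> laurent_map u f = laurent_map v f.
Proof. by move=> uv; apply: eq_bigr => l _; rewrite uv. Qed.

End LaurentMap.

(** * Gaussian binomial coefficients *)

Section QFibonacciRecurrence.
Variable F : fieldType.
Local Notation K := {fraction {poly F}}.
Local Notation Kx := {poly K}.
Local Notation L := (laurent Kx).
Local Notation q := (qvar F).
Local Notation s := (@smonom Kx).
Local Notation tofrac := (@FracField.tofrac _).
Implicit Types (f g h : L) (m : int).

Lemma one_sub_qX_neq0 n : 1 - q ^+ n.+1 != 0.
Proof. by rewrite subr_eq0 eq_sym qvarX_neq1. Qed.

Lemma one_sub_q_neq0 : 1 - q != 0.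
Proof. exact: one_sub_qX_neq0 0. Qed.

Lemma qvar_neq0 : q != 0.
Proof. by rewrite /qvar tofrac_eq0 polyX_eq0. Qed.

Lemma qfactS n : qfact F n.+1 = qfact F n * qint F n.+1.
Proof. by rewrite /qfact big_nat_recr. Qed.

Lemma qint_neq0 n : qint F n.+1 != 0.
Proof. by rewrite mulf_neq0 ?invr_neq0 ?one_sub_qX_neq0 ?one_sub_q_neq0. Qed.

Lemma qfact_neq0 n : qfact F n != 0.
Proof.
elim: n => [|n IHn]; first by rewrite /qfact big_nil oner_eq0.
by rewrite qfactS mulf_neq0 ?qint_neq0.
Qed.

Lemma qbinom0 n : qbinom F n 0 = 1.
Proof.
by rewrite /qbinom subn0 {2}/qfact big_nil mul1r divff ?qfact_neq0.
Qed.

Lemma qbinomnn n : qbinom F n n = 1.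
Proof.
by rewrite /qbinom subnn {3}/qfact big_nil mulr1 divff ?qfact_neq0.
Qed.

Lemma qint_muln n : qint F n * (1 - q) = 1 - q ^+ n.
Proof. by rewrite /qint mulfVK ?one_sub_q_neq0. Qed.

Lemma qintD d k : qint F (d + k) = qint F d + q ^+ d * qint F k.
Proof.
rewrite /qint mulrA -mulrDl; congr (_ / _).
by rewrite exprD mulrBr mulr1 addrA subrK.
Qed.

(** Writing the upper index as k + d keeps every factorial within the range
    where the truncated subtraction in [qbinom] is exact. *)
Lemma qbinom_absorb d k :
  (1 - q ^+ d.+1) * qbinom F (k + d).+1 k
  = (1 - q ^+ (k + d).+1) * qbinom F (k + d) k.
Proof.
rewrite -!qint_muln !(mulrAC _ (1 - q)); congr (_ * _).
rewrite /qbinom -addnS !addKn addnS !qfactS.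
exact: absorb_fractions (qfact_neq0 k) (qfact_neq0 d) (qint_neq0 d).
Qed.

Lemma qbinom_pascal d k :
  qbinom F (k + d).+2 k.+1
  = qbinom F (k + d).+1 k.+1 + q ^+ d.+1 * qbinom F (k + d).+1 k.
Proof.
rewrite /qbinom.
have -> : ((k + d).+2 - k.+1 = d.+1)%N by lia.
have -> : ((k + d).+1 - k.+1 = d)%N by lia.
have -> : ((k + d).+1 - k = d.+1)%N by lia.
rewrite [qfact F (k + d).+2]qfactS.
have -> : qint F (k + d).+2 = qint F d.+1 + q ^+ d.+1 * qint F k.+1.
  by rewrite -qintD; congr qint; lia.
rewrite !(qfactS k) !(qfactS d).
apply: pascal_fractions; [exact: qfact_neq0|exact: qfact_neq0|..];
  exact: qint_neq0.
Qed.

(** * Coefficients of the q-Fibonacci polynomials *)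

(** The coefficient of s^k x^(n-1-2k) in Fib_n.  Outside the range of summation
    [qbinom] has spurious values (its arguments are truncated), hence the
    explicit cut-off. *)
Definition fib_coef (n k : nat) : K :=
  if (2 * k < n)%N then q ^+ 'C(k.+1, 2) * qbinom F (n - 1 - k) k else 0.

Lemma coef_Fib n k :
  mcoeff k%:Z (Fib F n) = fib_coef n k *: ('X^(n - 1 - 2 * k) : Kx).
Proof.
rewrite /Fib big_mkord raddf_sum /=.
under eq_bigr => i _ do rewrite laurent_coefZ mcoeffU.
rewrite /fib_coef; case: ifP => [kn|kn].
  have kh : (k < n.+1./2)%N by lia.
  rewrite (bigD1 (Ordinal kh)) //= eqxx mulr1 big1 ?addr0 // => i ik.
  by rewrite eqz_nat (_ : _ == _ = false) ?mulr0 //; exact: negbTE ik.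
rewrite scale0r big1 // => i _; rewrite eqz_nat (_ : _ == _ = false) ?mulr0 //.
by have := ltn_ord i; lia.
Qed.

Lemma coef_Fib_neg n k : mcoeff (Negz k) (Fib F n) = 0.
Proof.
rewrite /Fib raddf_sum /= big1 // => i _.
by rewrite laurent_coefZ mcoeffU mulr0.
Qed.

Lemma fib_coef0 n : fib_coef n.+1 0 = 1.
Proof. by rewrite /fib_coef /= qbinom0 mulr1. Qed.

(** The factor q^(n-2k) - 1 comes from (q - 1) D x^(n-2k).  It vanishes for
    n = 2k, the only case in which exactly one term of the right-hand side lies
    within the range of summation while the left-hand side does not. *)
Lemma fib_coef_rec n k :
  fib_coef n.+2 k.+1
  = fib_coef n.+1 k.+1 + (q ^+ (n - 2 * k) - 1) * fib_coef n.+1 k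
    + fib_coef n k.
Proof.
rewrite /fib_coef; have [nk|nk|nk] := ltngtP n (2 * k)%N.
- have -> : (2 * k.+1 < n.+2)%N = false by lia.
  have -> : (2 * k.+1 < n.+1)%N = false by lia.
  have -> : (2 * k < n.+1)%N = false by lia.
  by rewrite mulr0 !addr0.
- have -> : (2 * k.+1 < n.+2)%N by lia.
  have -> : (2 * k < n.+1)%N by lia.
  rewrite !subSS !subn0 [(n - 1)%N]subn1.
  have binE : 'C(k.+2, 2) = (k.+1 + 'C(k.+1, 2))%N by rewrite binS bin1 addnC.
  rewrite binE exprD.
  case: ltnP => nk2.
    (* The generic case: all four coefficients are present. *)
    pose d := (n - 2 * k - 2)%N.
    have -> : (n - k.+1 = (k + d).+1)%N by rewrite /d; lia.
    have -> : (n - k = (k + d).+2)%N by rewrite /d; lia.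
    have -> : (n.-1 - k = (k + d).+1)%N by rewrite /d; lia.
    have -> : (n - 2 * k = d.+2)%N by rewrite /d; lia.
    rewrite qbinom_pascal; apply: fib_coef_identity.
    rewrite -exprD -addnS qbinom_absorb addnS.
    by congr ((1 - q ^+ _) * _); lia.
  (* On the boundary n = 2k + 1 the coefficient of s^(k+1) in Fib_(n+1) is
     absent, so the identity is used with a = 0 and r = b = 1. *)
  have {nk2} -> : n = (2 * k).+1 by lia.
  have -> : ((2 * k).+1 - k = k.+1)%N by lia.
  have -> : ((2 * k).+1.-1 - k = k)%N by lia.
  have -> : ((2 * k).+1 - 2 * k = 1)%N by lia.
  rewrite !qbinomnn.
  have := qbinom_absorb 0 k.
  rewrite addn0 qbinomnn -[q ^+ k.+1 in RHS]mulr1 => /fib_coef_identity.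
  move=> /(_ (q ^+ 'C(k.+1, 2)) 0).
  by rewrite !mulr1 add0r mulr0 add0r mulr1.
rewrite nk subnn subrr mul0r !addr0.
have -> : (2 * k.+1 < (2 * k).+2)%N = false by lia.
by have -> : (2 * k.+1 < (2 * k).+1)%N = false by lia.
Qed.

(** * The operators D, U and the substitutions *)

Lemma qderivD (g h : Kx) : qderiv (g + h) = qderiv g + qderiv h.
Proof. by rewrite /qderiv comp_polyD opprD addrACA divpD. Qed.

Lemma qderivZ (a : K) (g : Kx) : qderiv (a *: g) = a *: qderiv g.
Proof. by rewrite /qderiv comp_polyZ -scalerBr divpZl. Qed.

Lemma qderiv0 : qderiv (0 : Kx) = 0.
Proof. by rewrite -(scale0r (0 : Kx)) qderivZ !scale0r. Qed.

Lemma qderiv_monomial (a : K) n :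
  (q - 1)%:P * qderiv (a *: 'X^n) = ((q ^+ n - 1) * a) *: 'X^(n - 1).
Proof.
rewrite mul_polyC qderivZ scalerA (mulrC (q - 1)) (mulrC (q ^+ n - 1)).
rewrite -!scalerA; congr (_ *: _).
rewrite /qderiv comp_Xn_poly exprZn -{1}['X^n]scale1r -scalerBl.
rewrite divpZl divpZr ?one_sub_q_neq0 // !scalerA -(opprB 1) !mulNr.
rewrite mulrAC mulfV ?one_sub_q_neq0 // mul1r opprB.
case: n => [|n]; first by rewrite expr0 subrr !scale0r.
by rewrite (exprS 'X) mulKp ?polyX_eq0 // subSS subn0.
Qed.

Lemma coef_D f l : mcoeff l (D f) = qderiv (mcoeff l f).
Proof. by rewrite laurent_mapE // => _; apply: qderiv0. Qed.

Lemma DD f g : D (f + g) = D f + D g.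
Proof. by apply: laurent_map_add => [_|_]; [exact: qderiv0|exact: qderivD]. Qed.

(** Only scalars free of x commute with D. *)
Lemma DZ (a : K) f : D (a%:P *: f) = a%:P *: D f.
Proof.
apply: laurent_map_scale => [_|_ b]; first exact: qderiv0.
by rewrite !mul_polyC qderivZ.
Qed.

Lemma D0 : D (0 : L) = 0.
Proof.
by rewrite -(scale0r (0 : L)) -[X in X *: _]polyC0 DZ polyC0 !scale0r.
Qed.

Lemma D_smonomM k f : D (s k * f) = s k * D f.
Proof. by apply: laurent_map_smonomM => _; apply: qderiv0. Qed.

Lemma D_U m f : D (U m f) = U m (D f).
Proof.
have q0 (e : int -> K) l : e l *: (0 : Kx) = 0 by exact: scaler0.
have d0 (l : int) := qderiv0.
rewrite /D /U !laurent_map_comp //.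
by apply: eq_laurent_map => l a; rewrite qderivZ.
Qed.

Lemma D_ssubst i f : D (ssubst i f) = ssubst i (D f).
Proof.
have q0 (e : int -> K) l : e l *: (0 : Kx) = 0 by exact: scaler0.
have d0 (l : int) := qderiv0.
rewrite /D /ssubst !laurent_map_comp //.
by apply: eq_laurent_map => l a; rewrite qderivZ.
Qed.

Lemma UD m f g : U m (f + g) = U m f + U m g.
Proof. exact: linearD. Qed.

Lemma UZ m (a : Kx) f : U m (a *: f) = a *: U m f.
Proof. exact: linearZ. Qed.

(** Part (1), for an arbitrary f in place of Fib_n.  At s^(j+l) the left-hand
    side carries the weight m binom(j+l, 2) + i l, the right-hand side
    m binom(j, 2) + (i + m j) l + m binom(l, 2). *)
Lemma U_smonom_ssubst m i j f :
  U m (s j * ssubst i f)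
  = s j * ((q ^ (m * binz2 j))%:P *: ssubst (i + m * j) (U m f)).
Proof.
rewrite /U laurent_map_smonomM => [|l]; last exact: scaler0.
congr (_ * _).
rewrite /ssubst !laurent_map_comp => [|l|l|l|l]; rewrite ?scaler0 //.
rewrite scale_laurent_map => [|l]; last by rewrite !scaler0.
apply: eq_laurent_map => l a; rewrite mul_polyC !scalerA.
congr (_ *: _); rewrite -!expfzDr ?qvar_neq0 //.
by congr (q ^ _); rewrite binz2D; ring.
Qed.

Lemma ssubst0 f : ssubst 0 f = f.
Proof.
apply/malgP => l; rewrite laurent_mapE => [|*]; last exact: scaler0.
by rewrite mul0r expr0z scale1r.
Qed.

Lemma U_smonomM m k f :
  U m (s k * f) = s k * ((q ^ (m * binz2 k))%:P *: ssubst (m * k) (U m f)).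
Proof. by rewrite -[in LHS](ssubst0 f) U_smonom_ssubst add0r. Qed.

(** The case k = 1 carries no power of q in front, as binom(1, 2) = 0. *)
Lemma U_smonom1M m f : U m (s 1 * f) = s 1 * ssubst m (U m f).
Proof.
rewrite U_smonomM mulr1 (_ : binz2 1 = 0) // mulr0 expr0z polyC1.
by rewrite [1 *: _]scale1r.
Qed.

(** * The recurrences *)

(** The recurrence of part (2) for m = 0. *)
Lemma Fib_rec n :
  Fib F n.+2
  = 'X *: Fib F n.+1 + (q - 1)%:P *: (s 1 * D (Fib F n.+1)) + s 1 * Fib F n.
Proof.
apply/malgP => l; rewrite [RHS]coef_fib_step coef_D.
case: l => [[|k]|k].
- rewrite (_ : 0%:Z - 1 = Negz 0) // 2!coef_Fib_neg 2!coef_Fib !fib_coef0.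
  rewrite qderiv0 mulr0 !addr0.
  by rewrite !scale1r -exprS; congr ('X^_); lia.
- rewrite (_ : k.+1%:Z - 1 = k); last lia.
  rewrite 4!coef_Fib qderiv_monomial.
  rewrite (_ : n.+1 - 1 - 2 * k = n - 2 * k)%N; last lia.
  rewrite fib_coef_rec !scalerDl.
  have -> : (n.+2 - 1 - 2 * k.+1 = n - 1 - 2 * k)%N by lia.
  have -> : (n - 2 * k - 1 = n - 1 - 2 * k)%N by lia.
  congr (_ + _ + _); rewrite /fib_coef; case: ltnP => [kn|]; last first.
    by rewrite !scale0r mulr0.
  by rewrite -scalerAr -exprS; congr (_ *: 'X^_); lia.
- rewrite (_ : Negz k - 1 = Negz k.+1); last lia.
  rewrite 4!coef_Fib_neg.
  by rewrite qderiv0 !mulr0 !addr0.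
Qed.

(** U_m deforms the recurrence for m = 0 into the one for m, whatever its
    solution: each multiplication by s becomes s times the substitution
    s -> q^m s. *)
Lemma U_fib_rec m f g h :
  f = 'X *: g + (q - 1)%:P *: (s 1 * D g) + s 1 * h ->
  U m f = 'X *: U m g + (q - 1)%:P *: (s 1 * D (ssubst m (U m g)))
          + s 1 * ssubst m (U m h).
Proof.
move=> ->; rewrite UD UD UZ UZ.
by rewrite (U_smonom1M m h) (U_smonom1M m (D g)) -D_U -D_ssubst.
Qed.

Lemma Phi_rec m n :
  Phi F m n.+2
  = 'X *: Phi F m n.+1 + (q - 1)%:P *: (s 1 * D (ssubst m (Phi F m n.+1)))
    + s 1 * ssubst m (Phi F m n).
Proof. exact: U_fib_rec (Fib_rec n). Qed.

(** Weights in F(q) only: these polynomials in s commute with D. *)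
Definition spoly (r : seq nat) (w : nat -> K) : L :=
  \sum_(k <- r) (w k)%:P *: s k.

Lemma spoly_nil w : spoly [::] w = 0.
Proof. exact: big_nil. Qed.

Lemma spoly_cons k r w : spoly (k :: r) w = (w k)%:P *: s k + spoly r w.
Proof. exact: big_cons. Qed.

Lemma D_spolyM r w f : D (spoly r w * f) = spoly r w * D f.
Proof.
elim: r => [|k r IHr]; first by rewrite spoly_nil !mul0r D0.
by rewrite spoly_cons 2!mulrDl DD 2!laurent_scaleAl DZ D_smonomM IHr.
Qed.

Lemma spolyM_fib_rec r w f g h :
  f = 'X *: g + (q - 1)%:P *: (s 1 * D g) + s 1 * h ->
  spoly r w * f
  = 'X *: (spoly r w * g) + (q - 1)%:P *: (s 1 * D (spoly r w * g))
    + s 1 * (spoly r w * h).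
Proof. by move=> ->; rewrite D_spolyM; apply: mul_fib_step. Qed.

(** The factor q^(-m binom(k, 2)) cancels the power of q that U_m attaches to
    s^k. *)
Lemma U_weighted_term m k (a : K) f :
  U m (((a * q ^ (- (m * binz2 k)))%:P *: s k) * f)
  = a%:P *: (s k * ssubst (k * m) (U m f)).
Proof.
have qK e : a * q ^ (- e) * q ^ e = a.
  by rewrite -mulrA -expfzDr ?qvar_neq0 // addNr expr0z mulr1.
rewrite laurent_scaleAl UZ U_smonomM laurent_scaleAr [LHS]laurent_scaleA.
by rewrite -polyCM qK [m * k]mulrC.
Qed.

Lemma U_spolyM m r (c : nat -> K) f :
  U m (spoly r (fun k => c k * q ^ (- (m * binz2 k))) * f)
  = \sum_(k <- r) (c k)%:P *: (s k * ssubst (k%:Z * m) (U m f)).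
Proof.
elim: r => [|k r IHr].
  by rewrite spoly_nil mul0r big_nil; exact: linear0.
by rewrite spoly_cons mulrDl UD IHr U_weighted_term big_cons.
Qed.

(** The linear combination G_n is the image under U_m of a fixed multiple of
    Fib_n; the weights of this multiple do not depend on n, so the recurrence
    for Fib can be multiplied by it. *)
Lemma G_spoly m (c : {fsfun nat -> F with 0}) n :
  G m c n = U m (spoly (finsupp c)
    (fun k => tofrac (c k)%:P * q ^ (- (m * binz2 k))) * Fib F n).
Proof. by rewrite U_spolyM. Qed.

Lemma G_rec m (c : {fsfun nat -> F with 0}) n :
  G m c n.+2
  = 'X *: G m c n.+1 + (q - 1)%:P *: (s 1 * D (ssubst m (G m c n.+1)))
    + s 1 * ssubst m (G m c n).
Proof. by rewrite 3!G_spoly; apply/U_fib_rec/spolyM_fib_rec/Fib_rec. Qed.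

Lemma Phi_explicit m n :
  Phi F m n = \sum_(0 <= k < n.+1./2)
    ((q ^ ('C(k.+1, 2)%:Z + m * 'C(k, 2)%:Z) * qbinom F (n - 1 - k) k)
       *: 'X^(n - 1 - 2 * k)) *: s k.
Proof.
rewrite /Phi /Fib linear_sum /=; apply: eq_bigr => k _.
rewrite linearZ /= U_smonom scalerA mulrC mul_polyC scalerA binz2_nat.
by rewrite expfzDr ?qvar_neq0 // mulrA (mulrC (q ^ (m * _))).
Qed.

End QFibonacciRecurrence.

Theorem theorem5p3 (R : realType) (m : int) :
  let q := qvar R[i] in
  let x : {poly {fraction {poly R[i]}}} := 'X in
  let s (k : int) := smonom {poly {fraction {poly R[i]}}} k in
  [/\
      forall n : nat,
        Phi R[i] m n =
        \sum_(0 <= k < n.+1./2)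
          ((q ^ ('C(k.+1, 2)%:Z + m * 'C(k, 2)%:Z) * qbinom R[i] (n - 1 - k) k)
             *: x ^+ (n - 1 - 2 * k)) *: s k,
      forall (i j : int) (n : nat),
        U m (s j * ssubst i (Fib R[i] n)) =
        s j * ((q ^ (m * binz2 j))%:P *: ssubst (i + m * j) (Phi R[i] m n)),
      [/\ forall n : nat, (2 <= n)%N ->
            Phi R[i] m n =
            x *: Phi R[i] m (n - 1)
            + (q - 1)%:P *: (s 1 * D (ssubst m (Phi R[i] m (n - 1))))
            + s 1 * ssubst m (Phi R[i] m (n - 2)),
          Phi R[i] m 0 = 0
        & Phi R[i] m 1 = 1]
    & (* (3) *)
      forall (c : {fsfun nat -> R[i] with 0}) (n : nat), (2 <= n)%N ->
        G m c n =
        x *: G m c (n - 1)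
        + (q - 1)%:P *: (s 1 * D (ssubst m (G m c (n - 1))))
        + s 1 * ssubst m (G m c (n - 2))].
Proof.
move=> q x s; split.
- exact: Phi_explicit.
- by move=> i j n; apply: U_smonom_ssubst.
- split=> [[|[|n]] // _||].
  + by rewrite subn1 subn2; apply: Phi_rec.
  + by rewrite Phi_explicit big_geq.
  + rewrite Phi_explicit big_nat1 /= mulr0 expr0z mul1r qbinom0.
    by rewrite !scale1r.
- by move=> c [|[|n]] // _; rewrite subn1 subn2; apply: G_rec.
Qed.
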